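(* Let $n \geq 1$ and $d \in \mathbb{N}$, and let $\mathcal{X} \subseteq [-1,1]^n$ be a finite sample set that is non-degenerate up to degree $d$. Let $C_{n,d} := 4 \cdot s(n,d)\cdot d^2$ with $s(n,d) := \binom{n+d}{d}$, and let $\mathcal{Y}\subseteq[-1,1]^n$ be a finite sample set, non-degenerate up to degree $d$, such that $$C_{n,d}\cdot\|P^{\mu_{\mathcal{X}}}_d\|_\infty\cdot d_W(\mu_{\mathcal{X}},\mu_{\mathcal{Y}}) \leq 1/2.$$ Then $\|P^{\mu_{\mathcal{Y}}}_d\|_\infty \leq 2\|P^{\mu_{\mathcal{X}}}_d\|_\infty$. In particular, $$\|\log P^{\mu_{\mathcal{X}}}_d - \log P^{\mu_{\mathcal{Y}}}_d\|_\infty \leq \log\big(C_{n,d}\cdot 2\|P^{\mu_{\mathcal{X}}}_d\|_\infty\cdot d_W(\mu_{\mathcal{X}},\mu_{\mathcal{Y}})+1\big).$$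
   Context: $\mathbb{R}[\mathbf{x}]_d$ is the space of real polynomials in $n$ variables of total degree at most $d$. For a finite sample set $\mathcal{X}$ consisting of samples $X_1,\dots,X_N$, the empirical measure is $\mu_{\mathcal{X}} = \frac1N\sum_{i=1}^N \delta_{X_i}$, and $\langle p,q\rangle_{\mu_{\mathcal{X}}} := \frac1N\sum_{i=1}^N p(X_i)q(X_i)$. The sample set $\mathcal{X}$ is non-degenerate up to degree $d$ if $\langle\cdot,\cdot\rangle_{\mu_{\mathcal{X}}}$ is positive definite on $\mathbb{R}[\mathbf{x}]_d$ (i.e. no nonzero polynomial of degree at most $d$ vanishes on all samples). In that case, for any orthonormal basis $(b_\alpha)_{|\alpha|\le d}$ of $(\mathbb{R}[\mathbf{x}]_d, \langle\cdot,\cdot\rangle_{\mu_{\mathcal{X}}})$, the Christoffel polynomial is $P^{\mu_{\mathcal{X}}}_d(\mathbf{x}) := \sum_{|\alpha|\le d} b_\alpha(\mathbf{x})^2$ (independent of the choice of basis); it is strictly positive on $\mathbb{R}^n$. Supremum norm: $\|f\|_\infty := \max_{\mathbf{x}\in[-1,1]^n}|f(\mathbf{x})|$. The logarithm is to base 10. Wasserstein distance: for probability measures $\mu_{\mathcal{X}},\mu_{\mathcal{Y}}$ with finite supports $\mathcal{X},\mathcal{Y}$, $d_W(\mu_{\mathcal{X}},\mu_{\mathcal{Y}})$ is the minimum of $\sum_{\mathbf{x}\in\mathcal{X},\mathbf{y}\in\mathcal{Y}}\gamma(\mathbf{x},\mathbf{y})\|\mathbf{x}-\mathbf{y}\|_2$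 over all $\gamma:\mathcal{X}\times\mathcal{Y}\to\mathbb{R}_{\ge0}$ with $\sum_{\mathbf{y}}\gamma(\mathbf{x},\mathbf{y})=\mu_{\mathcal{X}}(\mathbf{x})$ for all $\mathbf{x}\in\mathcal{X}$ and $\sum_{\mathbf{x}}\gamma(\mathbf{x},\mathbf{y})=\mu_{\mathcal{Y}}(\mathbf{y})$ for all $\mathbf{y}\in\mathcal{Y}$. *)

(* Defs.v *)
From HB Require Import structures.
From mathcomp Require Import all_boot all_order all_algebra.
From mathcomp Require Import all_classical all_reals all_analysis.
From mathcomp Require Import -(notations) mpoly.
Set Implicit Arguments.
Unset Strict Implicit.
Unset Printing Implicit Defensive.
Import Order.TTheory GRing.Theory Num.Theory.
Local Open Scope classical_set_scope.
Local Open Scope ring_scope.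

(* The notations of [mpoly] clash with those of
   MathComp-Analysis and are not imported; [mpoly n R] is {mpoly R[n]}. *)

Definition peval (R : realType) (n : nat) (p : mpoly n R)
  (x : 'rV[R]_n) : R := meval (x ord0) p.

(* [msize p] is 1 + the total degree of p, and 0 for p = 0. *)
Definition in_poly_le (R : realType) (n d : nat) (p : mpoly n R) : Prop :=
  (msize p <= d.+1)%N.

(* A sample set is the finite sequence X_1, ..., X_N of its samples;
   repetitions are allowed, a set being the case [uniq X]. *)
Definition emp_mass (R : realType) (n : nat) (X : seq 'rV[R]_n)
  (x : 'rV[R]_n) : R := (count_mem x X)%:R / (size X)%:R.

Definition emp_supp (R : realType) (n : nat) (X : seq 'rV[R]_n) :
  seq 'rV[R]_n := undup X.

Definition emp_inner (R : realType) (n : nat) (X : seq 'rV[R]_n)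
  (p q : mpoly n R) : R :=
  (size X)%:R^-1 * \sum_(x <- X) peval p x * peval q x.

Definition nondegenerate_upto (R : realType) (n d : nat) (X : seq 'rV[R]_n) : Prop :=
  forall p : mpoly n R,
    in_poly_le d p -> p != 0 -> 0 < emp_inner X p p.

(* [bmultinom n d.+1] is the finite type of the multi-indices alpha
   in N^n with |alpha| <= d. *)
Definition orthonormal_basis (R : realType) (n d : nat) (X : seq 'rV[R]_n)
  (b : bmultinom n d.+1 -> mpoly n R) : Prop :=
  [/\ forall a, in_poly_le d (b a),
      forall a a', emp_inner X (b a) (b a') = (a == a')%:R
    & forall p : mpoly n R, in_poly_le d p ->
        exists c : bmultinom n d.+1 -> R, p = \sum_a c a *: b a].

(* When X is non-degenerate up to degree d, orthonormal bases exist and the sum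
   of squares is the same for all of them; otherwise none exists and the value
   is the junk 0. *)
Definition christoffel (R : realType) (n d : nat) (X : seq 'rV[R]_n) :
  mpoly n R :=
  xget 0 [set P | exists b : bmultinom n d.+1 -> mpoly n R,
                    orthonormal_basis X b /\ P = \sum_a b a ^+ 2].

Definition cube (R : realType) (n : nat) : set 'rV[R]_n :=
  [set x | forall i, -1 <= x ord0 i <= 1].
Arguments cube R n : clear implicits.

(* The functions this is applied to are continuous on the compact cube, so the
   supremum is a maximum. *)
Definition supnorm (R : realType) (n : nat) (f : 'rV[R]_n -> R) : R :=
  sup [set `|f x| | x in cube R n].

(* Euclidean norm; the library norm on 'rV[R]_n is the max norm. *)
Definition norm2 (R : realType) (n : nat) (x : 'rV[R]_n) : R :=
  Num.sqrt (\sum_(i < n) x ord0 i ^+ 2).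

(* Only the values of g on supp X * supp Y matter. *)
Definition coupling (R : realType) (n : nat) (X Y : seq 'rV[R]_n)
  (g : 'rV[R]_n -> 'rV[R]_n -> R) : Prop :=
  [/\ forall x y, x \in emp_supp X -> y \in emp_supp Y -> 0 <= g x y,
      forall x, x \in emp_supp X ->
        \sum_(y <- emp_supp Y) g x y = emp_mass X x
    & forall y, y \in emp_supp Y ->
        \sum_(x <- emp_supp X) g x y = emp_mass Y y].

Definition transport_cost (R : realType) (n : nat) (X Y : seq 'rV[R]_n)
  (g : 'rV[R]_n -> 'rV[R]_n -> R) : R :=
  \sum_(x <- emp_supp X) \sum_(y <- emp_supp Y) g x y * norm2 (x - y).

(* For nonempty X and Y the couplings form a nonempty compact set, so the
   infimum is a minimum. *)
Definition wasserstein (R : realType) (n : nat) (X Y : seq 'rV[R]_n) : R :=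
  inf [set transport_cost X Y g | g in coupling X Y].

Definition log10 (R : realType) (x : R) : R := ln x / ln 10.

Definition s_nd (n d : nat) : nat := 'C(n + d, d).

Definition C_const (n d : nat) : nat := (4 * s_nd n d * d ^ 2)%N.

(* Main.v *)
Require Import Defs.
From HB Require Import structures.
From mathcomp Require Import all_boot all_order all_algebra.
From mathcomp Require Import all_classical all_reals all_analysis.
From mathcomp Require Import ring lra zify.
From mathcomp Require Import -(notations) mpoly.
Set Implicit Arguments.
Unset Strict Implicit.
Unset Printing Implicit Defensive.
Import Order.TTheory GRing.Theory Num.Theory.
Local Open Scope classical_set_scope.
Local Open Scope ring_scope.

(* If [e = C_{n,d} * |P^X|_oo * d_W], then [|<p,p>_X - <p,p>_Y| <= e * <p,p>_X]
   for all [p] of degree at most [d]: a Markov-type inequality makes [p ^ 2]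
   Lipschitz on the cube in terms of [sup p ^ 2 <= |P^X|_oo * <p,p>_X], and a
   Lipschitz function is tested against a coupling.  Since [P(x)] is the maximum
   of [p(x) ^ 2 / <p,p>], this comparison of quadratic forms passes to the
   Christoffel polynomials pointwise:
   [P^Y <= P^X / (1 - e) <= (1 + 2e) P^X] and [P^X <= (1 + e) P^Y].
   The binomial factor in [C_{n,d}] exceeds [n * d], which leaves room for
   replacing Markov's [d ^ 2] by the elementary bound [2 * d ^ 3] and for
   comparing points one coordinate at a time. *)

(** * Cosine polynomials and a crude Markov inequality *)

Lemma norm_sin_muln_le (R : realType) (k : nat) (t : R) :
  `|sin (k%:R * t)| <= k%:R * `|sin t|.
Proof.
elim: k => [|k IHk]; first by rewrite !mul0r sin0 normr0.
rewrite -natr1 !mulrDl !mul1r sinD.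
apply: (le_trans (ler_normD _ _)); rewrite !normrM lerD //.
  by apply: le_trans IHk; rewrite ler_piMr ?cos_max.
by rewrite ler_piMl ?cos_max.
Qed.

Lemma cos_sub_cos (R : realType) (a b : R) :
  cos a - cos b = - 2 * (sin ((a + b) / 2) * sin ((a - b) / 2)).
Proof.
have {1}-> : a = (a + b) / 2 + (a - b) / 2 by field.
have {3}-> : b = (a + b) / 2 - (a - b) / 2 by field.
by rewrite cosD cosB; ring.
Qed.

(** Both differences split into sines of the half sum and the half difference, and each sine costs a
    factor [k]. In the variable [cos t] this says that the k-th Chebyshev polynomial is
    [k ^ 2]-Lipschitz. *)
Lemma norm_cos_muln_sub_le (R : realType) (k : nat) (a b : R) :
  `|cos (k%:R * a) - cos (k%:R * b)| <= k%:R ^+ 2 * `|cos a - cos b|.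
Proof.
rewrite !cos_sub_cos !normrM -mulrDr -mulrBr -!(mulrA k%:R).
rewrite [leRHS](_ : _ = `|- 2| * ((k%:R * `|sin ((a + b) / 2)|) *
  (k%:R * `|sin ((a - b) / 2)|))); last by ring.
by rewrite ler_wpM2l // ler_pM // norm_sin_muln_le.
Qed.

(** These are the functions that polynomials of degree at most [d] become under the substitution
    [x = cos t]. *)
Definition cos_poly (R : realType) (d : nat) (f : R -> R) : Prop :=
  exists a : nat -> R, forall t, f t = \sum_(j < d.+1) a j * cos (j%:R * t).

Lemma cos_poly0 (R : realType) (d : nat) : cos_poly d (fun=> 0 : R).
Proof.
by exists (fun=> 0) => t; rewrite big1 // => j _; rewrite mul0r.
Qed.

Lemma cos_polyD (R : realType) (d : nat) (f g : R -> R) :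
  cos_poly d f -> cos_poly d g -> cos_poly d (fun t => f t + g t).
Proof.
move=> [a fE] [b gE]; exists (fun j => a j + b j) => t.
by rewrite fE gE -big_split; apply: eq_bigr => j _; rewrite mulrDl.
Qed.

Lemma cos_polyZ (R : realType) (d : nat) (c : R) (f : R -> R) :
  cos_poly d f -> cos_poly d (fun t => c * f t).
Proof.
move=> [a fE]; exists (fun j => c * a j) => t.
by rewrite fE mulr_sumr; apply: eq_bigr => j _; rewrite mulrA.
Qed.

Lemma cos_poly_sum (R : realType) (d m : nat) (f : 'I_m -> R -> R) :
  (forall i, cos_poly d (f i)) -> cos_poly d (fun t => \sum_i f i t).
Proof.
elim: m f => [|m IHm] f hf.
  by have [a ha] := cos_poly0 R d; exists a => t; rewrite big_ord0 -ha.
have [a ha] := cos_polyD (hf ord0) (IHm _ (fun i => hf (lift ord0 i))).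
by exists a => t; rewrite big_ord_recl -ha.
Qed.

Lemma cos_poly_cos (R : realType) (d k : nat) :
  (k <= d)%N -> cos_poly d (fun t : R => cos (k%:R * t)).
Proof.
move=> kd; exists (fun j => (j == k)%:R) => t.
rewrite (bigD1 (Ordinal (kd : (k < d.+1)%N))) //= eqxx mul1r big1 ?addr0 //.
by move=> j; rewrite -val_eqE /= => /negPf ->; rewrite mul0r.
Qed.

(** The product formula turns [cos t * cos (j t)] into the mean of the cosines of [(j + 1) t] and
    [(j - 1) t]. The case [j = 0] is separate, as [j - 1] leaves the naturals. *)
Lemma cos_poly_mulcos (R : realType) (d : nat) (f : R -> R) :
  cos_poly d f -> cos_poly d.+1 (fun t => cos t * f t).
Proof.
move=> [a fE].
suff h (j : 'I_d.+1) : cos_poly d.+1 (fun t => a j * (cos t * cos (j%:R * t))).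
  have [b bE] := cos_poly_sum h.
  exists b => t; rewrite -bE fE mulr_sumr.
  by apply: eq_bigr => i _; rewrite mulrCA.
apply: cos_polyZ.
case: j => -[|k] /= hk.
  have [b bE] := cos_poly_cos R (isT : 0 < d.+2)%N.
  have [//|c cE] := @cos_poly_cos R d.+1 1.
  by exists c => t; rewrite -cE mul0r cos0 mulr1 mul1r.
have h1 : (k.+2 <= d.+1)%N by [].
have h2 : (k <= d.+1)%N by rewrite (leq_trans (ltnW (ltnW hk))).
have [b bE] := cos_polyD (cos_polyZ 2^-1 (cos_poly_cos R h1))
  (cos_polyZ 2^-1 (cos_poly_cos R h2)).
exists b => t; rewrite -bE.
have -> : k.+2%:R * t = k.+1%:R * t + t by rewrite -[k.+2%:R]natr1; ring.
have -> : k%:R * t = k.+1%:R * t - t by rewrite -[k.+1%:R]natr1; ring.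
by rewrite cosD cosB; field.
Qed.

Lemma cos_poly_expcos (R : realType) (d k : nat) :
  (k <= d)%N -> cos_poly d (fun t : R => cos t ^+ k).
Proof.
elim: k d => [|k IHk] d kd.
  have [a aE] := cos_poly_cos R kd.
  by exists a => t; rewrite -aE mul0r cos0.
case: d kd => // d kd.
have [a aE] := cos_poly_mulcos (IHk d kd).
by exists a => t; rewrite -aE exprS.
Qed.

Lemma cos_poly_horner (R : realType) (d : nat) (p : {poly R}) :
  (size p <= d.+1)%N -> cos_poly d (fun t => p.[cos t]).
Proof.
move=> hp.
have [i|a aE] := @cos_poly_sum R d d.+1 (fun i t => p`_i * cos t ^+ i).
  by apply/cos_polyZ/cos_poly_expcos; rewrite -ltnS.
by exists a => t; rewrite -aE (horner_coef_wide _ hp).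
Qed.

(** The angles are those of the Chebyshev nodes. Multiplying by [sin h] makes the sum telescope to
    [sin (m * pi) / 2 = 0], and [0 < m < 2N] keeps [sin h] positive. *)
Lemma sum_cos_nodes (R : realType) (N m : nat) :
  (0 < m < N.*2)%N ->
  \sum_(j < N) cos (m%:R * (j.*2.+1%:R * pi / N.*2%:R)) = 0 :> R.
Proof.
move=> /andP[m0 mN].
have N0 : 0 < N.*2%:R :> R by rewrite ltr0n (leq_trans _ mN).
set h : R := m%:R * pi / N.*2%:R.
have h0 : 0 < sin h.
  apply: sin_gt0_pi; apply/andP; split.
    by rewrite divr_gt0 // mulr_gt0 ?pi_gt0 // ltr0n.
  by rewrite ltr_pdivrMr // mulrC ltr_pM2l ?pi_gt0 // ltr_nat.
apply: (mulfI (lt0r_neq0 h0)); rewrite mulr0.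
have tele n : sin h * (\sum_(j < n) cos (m%:R * (j.*2.+1%:R * pi / N.*2%:R)))
    = sin (n.*2%:R * h) / 2.
  elim: n => [|n IHn]; first by rewrite big_ord0 mulr0 double0 mul0r sin0 mul0r.
  rewrite big_ord_recr mulrDr IHn /= doubleS.
  have -> : m%:R * (n.*2.+1%:R * pi / N.*2%:R) = n.*2.+1%:R * h.
    by rewrite /h; field; exact: lt0r_neq0.
  have -> : n.*2%:R * h = n.*2.+1%:R * h - h by rewrite -[n.*2.+1%:R]natr1; ring.
  have -> : n.*2.+2%:R * h = n.*2.+1%:R * h + h by rewrite -[n.*2.+2%:R]natr1; ring.
  by rewrite sinB sinD; field.
have sin_kpi k : sin (k%:R * pi) = 0 :> R.
  elim: k => [|k IHk]; first by rewrite mul0r sin0.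
  by rewrite -natr1 mulrDl mul1r sinD sinpi mulr0 IHk mul0r addr0.
rewrite tele; suff -> : N.*2%:R * h = m%:R * pi by rewrite sin_kpi mul0r.
by rewrite /h; field; exact: lt0r_neq0.
Qed.

(** Discrete orthogonality: the product formula reduces the sum to [sum_cos_nodes] at the
    frequencies [l + k] and [|l - k|]. *)
Lemma sum_cos_cos_nodes (R : realType) (N k l : nat) :
  (0 < k)%N -> (k < N)%N -> (l < N)%N ->
  \sum_(j < N) cos (l%:R * (j.*2.+1%:R * pi / N.*2%:R)) *
               cos (k%:R * (j.*2.+1%:R * pi / N.*2%:R))
    = (l == k)%:R * (N%:R / 2) :> R.
Proof.
set theta := fun j : nat => j.*2.+1%:R * pi / N.*2%:R : R.
(* The order [v <= u] makes the natural-number subtraction [u - v] a true difference. *)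
have half u v : (0 < u + v)%N -> (v <= u)%N -> (u < N)%N ->
    \sum_(j < N) cos (u%:R * theta j) * cos (v%:R * theta j)
      = (u == v)%:R * (N%:R / 2).
  move=> uv0 vu uN.
  have uvN : (u + v < N.*2)%N.
    by rewrite -addnn -addSn leq_add // ltnW // (leq_ltn_trans vu).
  transitivity ((\sum_(j < N) cos ((u + v)%:R * theta j)
                 + \sum_(j < N) cos ((u - v)%:R * theta j)) / 2).
    rewrite -big_split mulr_suml; apply: eq_bigr => j _ /=.
    rewrite natrD (natrB _ vu) (mulrDl _ _ (theta j)).
    by rewrite (mulrBl (theta j)) cosB cosD; field.
  rewrite sum_cos_nodes ?uv0 // add0r.
  have [<-|uv] := eqVneq u v.
    rewrite subnn (eq_bigr (fun=> 1)) => [|j _]; last by rewrite mul0r cos0.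
    by rewrite sumr_const card_ord mul1r.
  rewrite sum_cos_nodes ?mul0r // subn_gt0 ltn_neqAle eq_sym uv vu /=.
  by rewrite (leq_ltn_trans _ uvN) // (leq_trans (leq_subr _ _)) // leq_addr.
move=> k0 kN lN; have [lk|/ltnW kl] := leqP l k; last first.
  by rewrite half // addn_gt0 k0 orbT.
by under eq_bigr do rewrite mulrC; rewrite half 1?eq_sym // addn_gt0 k0.
Qed.

(** By orthogonality on [d + 1] nodes, [a k] is twice the average of the products of [f] with
    [cos (k t)] over the nodes. For [k = 0] the normalization would be different. *)
Lemma norm_cos_coef_le (R : realType) (d k : nat) (a : nat -> R) (M : R) :
  (forall t, `|\sum_(j < d.+1) a j * cos (j%:R * t)| <= M) ->
  (0 < k <= d)%N -> `|a k| <= 2 * M.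
Proof.
move=> fM /andP[k0 kd].
set theta := fun j : nat => j.*2.+1%:R * pi / d.+1.*2%:R : R.
have E : \sum_(j < d.+1) (\sum_(l < d.+1) a l * cos (l%:R * theta j)) *
           cos (k%:R * theta j) = a k * (d.+1%:R / 2).
  under eq_bigr do rewrite mulr_suml.
  rewrite exchange_big /= (bigD1 (Ordinal (kd : (k < d.+1)%N))) //=.
  rewrite [X in _ + X]big1 ?addr0 => [|l lk].
    under eq_bigr do rewrite -mulrA.
    by rewrite -mulr_sumr sum_cos_cos_nodes // eqxx mul1r.
  under eq_bigr do rewrite -mulrA.
  rewrite -mulr_sumr sum_cos_cos_nodes //.
  by move: lk; rewrite -val_eqE /= => /negPf ->; rewrite mul0r mulr0.
have : `|a k * (d.+1%:R / 2)| <= \sum_(j < d.+1) M.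
  rewrite -E; apply: (le_trans (ler_norm_sum _ _ _)); apply: ler_sum => j _.
  rewrite normrM; apply: le_trans (fM (theta j)).
  by rewrite ler_piMr ?cos_max.
rewrite sumr_const card_ord normrM [`|_ / 2|]ger0_norm ?divr_ge0 //.
rewrite -[M *+ _]mulr_natr [leRHS](_ : _ = 2 * M * (d.+1%:R / 2)); last by field.
by rewrite ler_pM2r // divr_gt0 // ltr0n.
Qed.

(* A crude Markov inequality (the sharp constant is [d ^ 2]): the coefficients
   of [p (cos t)] in the basis [cos (k t)] are at most [2 * M], and the k-th
   Chebyshev polynomial is [k ^ 2]-Lipschitz. *)
Lemma horner_lipschitz (R : realType) (d : nat) (p : {poly R}) (M x y : R) :
  (size p <= d.+1)%N -> (forall t, -1 <= t <= 1 -> `|p.[t]| <= M) ->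
  -1 <= x <= 1 -> -1 <= y <= 1 ->
  `|p.[x] - p.[y]| <= 2 * d%:R ^+ 3 * M * `|x - y|.
Proof.
move=> hp pM hx hy; have [a aE] := cos_poly_horner hp.
have aM t : `|\sum_(j < d.+1) a j * cos (j%:R * t)| <= M.
  by rewrite -aE pM // cos_geN1 cos_le1.
have M0 : 0 <= M by apply: le_trans (pM x hx).
(* After [x = cos (acos x)], the constant term cancels in the difference and [d] terms remain. *)
rewrite -[x]acosK ?in_itv // -[y]acosK ?in_itv // !aE -sumrB big_ord_recl.
rewrite /= !mul0r subrr add0r.
apply: (le_trans (ler_norm_sum _ _ _)).
apply: (@le_trans _ _ (\sum_(j < d) 2 * M * (d%:R ^+ 2 *
    `|cos (acos x) - cos (acos y)|))).
  apply: ler_sum => j _; rewrite -mulrBr normrM ler_pM //.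
    by apply: (norm_cos_coef_le aM); rewrite /= ltn_ord.
  apply: (le_trans (norm_cos_muln_sub_le _ _ _)); rewrite ler_wpM2r //.
  by rewrite lerXn2r ?nnegrE // ler_nat /bump /= ltn_ord.
rewrite sumr_const card_ord -mulr_natl le_eqVlt; apply/orP; left; apply/eqP.
by ring.
Qed.

(** * Lipschitz bounds for polynomials on the cube *)

Lemma peval_coord (R : realType) (n d : nat) (p : mpoly n R) (x : 'rV[R]_n)
    (i : 'I_n) : in_poly_le d p ->
  exists2 q : {poly R}, (size q <= d.+1)%N &
    forall y : 'rV[R]_n, (forall j, j != i -> y ord0 j = x ord0 j) ->
      peval p y = q.[y ord0 i].
Proof.
move=> pd.
(* The coordinates other than [i] are frozen at those of [x] and absorbed into the coefficients. *)
exists (\sum_(m <- msupp p)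
  (mcoeff m p * \prod_(j | j != i) x ord0 j ^+ m j) *: 'X^(m i)).
  apply/(leq_trans (size_sum _ _ _))/bigmax_leqP_seq => m mp _.
  apply/(leq_trans (size_scale_leq _ _)); rewrite size_polyXn ltnS.
  have /leq_trans/(_ pd) := msize_mdeg_lt mp; rewrite ltnS; apply: leq_trans.
  by rewrite mdegE (bigD1 i) //= leq_addr.
move=> y yx; rewrite /peval mevalE horner_sum; apply: eq_bigr => m _.
rewrite hornerZ hornerXn -mulrA (bigD1 i) //= [_ * (y _ _ ^+ _)]mulrC.
by congr (_ * (_ * _)); apply: eq_bigr => j ji; rewrite yx.
Qed.

Lemma peval_lipschitz_coord (R : realType) (n d : nat) (p : mpoly n R) (M : R)
    (x y : 'rV[R]_n) (i : 'I_n) :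
  in_poly_le d p -> (forall z, cube R n z -> `|peval p z| <= M) ->
  cube R n x -> cube R n y -> (forall j, j != i -> y ord0 j = x ord0 j) ->
  `|peval p x - peval p y| <= 2 * d%:R ^+ 3 * M * `|x ord0 i - y ord0 i|.
Proof.
move=> pd pM hx hy yx; have [q qd qE] := peval_coord x i pd.
rewrite (qE y) // (qE x) //; apply: horner_lipschitz => //.
(* Moving only coordinate [i] within [[-1, 1]] stays in the cube, so [q] inherits the bound [M]. *)
move=> t ht; pose z : 'rV[R]_n := \row_j if j == i then t else x ord0 j.
have <- : z ord0 i = t by rewrite mxE eqxx.
rewrite -qE => [|j /negPf ji]; last by rewrite mxE ji.
by apply: pM => j; rewrite mxE; case: ifP.
Qed.

Lemma norm_coord_le_norm2 (R : realType) (n : nat) (x : 'rV[R]_n) (i : 'I_n) :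
  `|x ord0 i| <= norm2 x.
Proof.
rewrite -sqrtr_sqr ler_sqrt ?sumr_ge0 // => [|j _]; last exact: sqr_ge0.
by rewrite (bigD1 i) //= lerDl sumr_ge0 // => j _; exact: sqr_ge0.
Qed.

Lemma peval_lipschitz (R : realType) (n d : nat) (p : mpoly n R) (M : R)
    (x y : 'rV[R]_n) :
  in_poly_le d p -> (forall z, cube R n z -> `|peval p z| <= M) ->
  cube R n x -> cube R n y ->
  `|peval p x - peval p y| <= n%:R * (2 * d%:R ^+ 3 * M * norm2 (x - y)).
Proof.
move=> pd pM hx hy; have M0 : 0 <= M by apply: le_trans (pM x hx).
(* A path from [x] to [y] that changes one coordinate at a time: [z k] has the first [k] coordinates
   of [y] and the others of [x]. *)
pose z k : 'rV[R]_n := \row_j if (j < k)%N then y ord0 j else x ord0 j.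
have hz k : cube R n (z k) by move=> j; rewrite mxE; case: ifP.
have zE : y = z n by apply/rowP => j; rewrite mxE ltn_ord.
suff h k : (k <= n)%N -> `|peval p x - peval p (z k)| <=
    k%:R * (2 * d%:R ^+ 3 * M * norm2 (x - y)) by rewrite {1}zE h.
elim: k => [_|k IHk kn].
  have -> : z 0%N = x by apply/rowP => j; rewrite mxE.
  by rewrite subrr normr0 mul0r.
apply: (le_trans (ler_distD (peval p (z k)) _ _)).
rewrite -natr1 mulrDl mul1r; apply: lerD; first exact/IHk/ltnW.
pose i := Ordinal kn.
apply: (le_trans (peval_lipschitz_coord (i := i) pd pM (hz k) (hz k.+1) _)).
  move=> j; rewrite -val_eqE !mxE /= => ji.
  by rewrite ltnS leq_eqVlt (negPf ji).
rewrite ler_wpM2l ?mulr_ge0 ?exprn_ge0 //.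
rewrite !mxE /= ltnn leqnn -[_ - _](_ : (x - y) ord0 i = _); last by rewrite !mxE.
exact: norm_coord_le_norm2.
Qed.

(** * Orthonormal bases and the Christoffel polynomial *)

Lemma peval_sum (R : realType) (n : nat) (I : Type) (r : seq I)
    (c : I -> R) (b : I -> mpoly n R) (x : 'rV[R]_n) :
  peval (\sum_(a <- r) c a *: b a) x = \sum_(a <- r) c a * peval (b a) x.
Proof.
rewrite /peval raddf_sum; apply: eq_bigr => a _; exact: mevalZ.
Qed.

Lemma emp_innerC (R : realType) (n : nat) (X : seq 'rV[R]_n)
    (p q : mpoly n R) : emp_inner X p q = emp_inner X q p.
Proof. by congr (_ * _); apply: eq_bigr => x _; rewrite mulrC. Qed.

Lemma emp_innerZl (R : realType) (n : nat) (X : seq 'rV[R]_n) (c : R)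
    (p q : mpoly n R) : emp_inner X (c *: p) q = c * emp_inner X p q.
Proof.
rewrite /emp_inner mulrCA; congr (_ * _); rewrite mulr_sumr.
by apply: eq_bigr => x _; rewrite /peval mevalZ mulrA.
Qed.

Lemma emp_innerBl (R : realType) (n : nat) (X : seq 'rV[R]_n)
    (p q r : mpoly n R) :
  emp_inner X (p - q) r = emp_inner X p r - emp_inner X q r.
Proof.
rewrite /emp_inner -mulrBr; congr (_ * _); rewrite -sumrB.
by apply: eq_bigr => x _; rewrite /peval mevalB mulrBl.
Qed.

Lemma emp_inner_suml (R : realType) (n : nat) (X : seq 'rV[R]_n)
    (I : Type) (r : seq I) (c : I -> R) (b : I -> mpoly n R) (q : mpoly n R) :
  emp_inner X (\sum_(a <- r) c a *: b a) q
    = \sum_(a <- r) c a * emp_inner X (b a) q.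
Proof.
under [RHS]eq_bigr do rewrite /emp_inner mulrCA.
rewrite -mulr_sumr /emp_inner; congr (_ * _).
under eq_bigr do rewrite peval_sum mulr_suml.
rewrite exchange_big; apply: eq_bigr => a _; rewrite mulr_sumr.
by apply: eq_bigr => x _; rewrite mulrA.
Qed.

Lemma in_poly_leP (R : realType) (n d : nat) (p : mpoly n R) :
  (forall m, (d < mdeg m)%N -> mcoeff m p = 0) -> in_poly_le d p.
Proof.
move=> hp; rewrite /in_poly_le msizeE; apply/bigmax_leqP_seq => m mp _.
by rewrite ltnNge; apply: contraTN mp => /hp/eqP; rewrite mcoeff_eq0.
Qed.

(** Gram-Schmidt on the monomials, by induction on the list of exponents. The support condition
    keeps the new vector nonzero and of degree at most [d], so that non-degeneracy applies to it. *)
Lemma gram_schmidt (R : realType) (n d : nat) (X : seq 'rV[R]_n)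
    (s : seq (bmultinom n d.+1)) :
  nondegenerate_upto d X -> uniq s ->
  exists b : bmultinom n d.+1 -> mpoly n R,
    [/\ {in s, forall a (k : multinom n), k \notin [seq bmnm a | a <- s] ->
          mcoeff k (b a) = 0},
        {in s &, forall a a', emp_inner X (b a) (b a') = (a == a')%:R}
      & {in s, forall a, exists c : bmultinom n d.+1 -> R,
          mpolyX R (bmnm a) = \sum_(a' <- s) c a' *: b a'}].
Proof.
move=> hX; elim: s => [|m s IHs] /=; first by exists (fun=> 0).
case/andP=> ms us; have {IHs} [b [bsupp bon bspan]] := IHs us.
have mmap : bmnm m \notin [seq bmnm a | a <- s].
  by rewrite (mem_map val_inj).
pose c a := emp_inner X (mpolyX R (bmnm m)) (b a).
pose v := mpolyX R (bmnm m) - \sum_(a <- s) c a *: b a.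
have vE k : mcoeff k v = (bmnm m == k)%:R - \sum_(a <- s) c a * mcoeff k (b a).
  rewrite mcoeffB mcoeffX raddf_sum; congr (_ - _).
  by apply: eq_bigr => a _; exact: mcoeffZ.
have vsupp k : k \notin [seq bmnm a | a <- m :: s] -> mcoeff k v = 0.
  rewrite inE negb_or => /andP[km ks].
  rewrite vE eq_sym (negPf km) sub0r big_seq big1 ?oppr0 // => a as_.
  by rewrite bsupp ?mulr0.
(* The earlier vectors have no term in the new monomial, so its coefficient in [v] is 1. *)
have v0 : v != 0.
  apply/eqP => /(congr1 (mcoeff (bmnm m))); rewrite vE mcoeff0 eqxx big_seq.
  rewrite big1 => [|a as_]; last by rewrite bsupp ?mulr0.
  by rewrite subr0 => /eqP; rewrite oner_eq0.
have vd : in_poly_le d v.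
  apply: in_poly_leP => k dk; apply: vsupp.
  by apply: contraL dk => /mapP[a _ ->]; rewrite -leqNgt -ltnS bmdeg.
have vv := hX v vd v0.
have vb a : a \in s -> emp_inner X v (b a) = 0.
  move=> as_; rewrite emp_innerBl emp_inner_suml (bigD1_seq a) //= bon // eqxx.
  rewrite mulr1 big_seq_cond big1 ?addr0 ?subrr // => a' /andP[a's a'a].
  by rewrite bon // (negPf a'a) mulr0.
set r := Num.sqrt (emp_inner X v v).
have r0 : r != 0 by rewrite gt_eqF // sqrtr_gt0.
pose w := r^-1 *: v.
have wb a : a \in s -> emp_inner X w (b a) = 0.
  by move=> as_; rewrite emp_innerZl vb // mulr0.
have ww : emp_inner X w w = 1.
  rewrite emp_innerZl emp_innerC emp_innerZl -[X in _ * (_ * X)]sqr_sqrtr ?ltW //.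
  by rewrite -/r; field.
pose b' a := if a == m then w else b a.
have b's a : a \in s -> b' a = b a.
  by rewrite /b'; case: eqP => // -> /(negP ms).
have b'm : b' m = w by rewrite /b' eqxx.
exists b'; split.
- move=> a; rewrite inE => /predU1P[->|as_] k hk.
    by rewrite b'm mcoeffZ vsupp ?mulr0.
  by rewrite b's // bsupp //; move: hk; rewrite inE negb_or => /andP[].
- move=> a a'; rewrite !inE => /predU1P[->|as_] /predU1P[->|a's];
    rewrite ?b'm ?b's ?eqxx //.
  + by rewrite wb //; case: eqP a's => // <- /(negP ms).
  + by rewrite emp_innerC wb //; case: eqP as_ => // -> /(negP ms).
  + exact: bon.
(* The coefficient at [m] is [r] for the new monomial, since [r *: w = v], and 0 for the older ones,
   whose expansions are kept. *)
- have ext (c' : bmultinom n d.+1 -> R) t : \sum_(a' <- m :: s)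
      (if a' == m then t else c' a') *: b' a'
      = t *: w + \sum_(a' <- s) c' a' *: b a'.
    rewrite big_cons eqxx b'm; congr (_ + _); rewrite !big_seq.
    apply: eq_bigr => a as_; rewrite b's //.
    by case: eqP as_ => // -> /(negP ms).
  move=> a; rewrite inE => /predU1P[->|as_].
    exists (fun a' => if a' == m then r else c a').
    by rewrite ext scalerA mulfV // scale1r subrK.
  have [c' ->] := bspan a as_.
  by exists (fun a' => if a' == m then 0 else c' a'); rewrite ext scale0r add0r.
Qed.

Lemma orthonormal_basis_exists (R : realType) (n d : nat)
    (X : seq 'rV[R]_n) : nondegenerate_upto d X ->
  exists b : bmultinom n d.+1 -> mpoly n R, orthonormal_basis X b.
Proof.
move=> hX.
have [b [bsupp bon bspan]] := gram_schmidt hX (index_enum_uniq (bmultinom n d.+1)).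
exists b; split.
- move=> a; apply: in_poly_leP => k dk; apply: bsupp; first exact: mem_index_enum.
  by apply: contraL dk => /mapP[a' _ ->]; rewrite -leqNgt -ltnS bmdeg.
- by move=> a a'; apply: bon; exact: mem_index_enum.
- move=> p pd.
  have [c cE] := boolp.choice (fun a => bspan a (mem_index_enum a)).
  (* Expand [p] in monomials, then each monomial in the basis, and exchange the sums. *)
  exists (fun a' => \sum_(a : bmultinom n d.+1) mcoeff (bmnm a) p * c a a').
  rewrite {1}(mpolywE pd).
  under eq_bigr do rewrite cE scaler_sumr.
  rewrite exchange_big; apply: eq_bigr => a' _ /=.
  by rewrite scaler_suml; apply: eq_bigr => a _; rewrite scalerA.
Qed.

(** Existence of an orthonormal basis rules out the default value of [xget]. *)
Lemma christoffelP (R : realType) (n d : nat) (X : seq 'rV[R]_n) :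
  nondegenerate_upto d X ->
  exists2 b : bmultinom n d.+1 -> mpoly n R, orthonormal_basis X b &
    forall x, peval (christoffel d X) x = \sum_a peval (b a) x ^+ 2.
Proof.
move=> /orthonormal_basis_exists[b0 b0on].
have [b [bon PE]] : [set P | exists b : bmultinom n d.+1 -> mpoly n R,
    orthonormal_basis X b /\ P = \sum_a b a ^+ 2] (christoffel d X).
  by apply: xgetPex; exists (\sum_a b0 a ^+ 2), b0.
exists b => // x; rewrite PE /peval raddf_sum; apply: eq_bigr => a _.
by rewrite !expr2 /= mevalM.
Qed.

(** * Extremal property of the Christoffel polynomial *)

Lemma sqr_sum_mul_le (R : realType) (I : finType) (u v : I -> R) :
  (\sum_i u i * v i) ^+ 2 <= (\sum_i u i ^+ 2) * (\sum_i v i ^+ 2).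
Proof.
set S := \sum_i u i * v i; set A := \sum_i u i ^+ 2; set B := \sum_i v i ^+ 2.
have B0 : 0 <= B by apply: sumr_ge0 => i _; exact: sqr_ge0.
(* Cauchy-Schwarz: this sum equals [B * (A * B - S ^ 2)], which settles [B > 0]; if [B = 0], every
   [v i] vanishes. *)
have : 0 <= \sum_i (B * u i - S * v i) ^+ 2.
  by apply: sumr_ge0 => i _; exact: sqr_ge0.
have -> : \sum_i (B * u i - S * v i) ^+ 2 = B * (A * B - S ^+ 2).
  transitivity (B ^+ 2 * A - (2 * B * S) * S + S ^+ 2 * B); last by ring.
  rewrite [B ^+ 2 * A]mulr_sumr [_ * S]mulr_sumr [S ^+ 2 * B]mulr_sumr.
  by rewrite -sumrB -big_split; apply: eq_bigr => i _ /=; ring.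
have [B_gt0|] := ltrP 0 B; first by rewrite pmulr_rge0 // subr_ge0.
move=> B_le0 _; have BE : B = 0 by apply/le_anti/andP.
have v0 i : v i = 0.
  apply/eqP; rewrite -sqrf_eq0; move/eqP: BE.
  by rewrite psumr_eq0 => [/allP/(_ i (mem_index_enum i))|j _]; last exact: sqr_ge0.
by rewrite BE mulr0 /S big1 ?expr0n // => i _; rewrite v0 mulr0.
Qed.

Lemma emp_inner_orthonormal (R : realType) (n d : nat) (X : seq 'rV[R]_n)
    (b : bmultinom n d.+1 -> mpoly n R) (c : bmultinom n d.+1 -> R) :
  orthonormal_basis X b ->
  emp_inner X (\sum_a c a *: b a) (\sum_a c a *: b a) = \sum_a c a ^+ 2.
Proof.
case=> _ bon _; rewrite emp_inner_suml; apply: eq_bigr => a _.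
rewrite emp_innerC emp_inner_suml (bigD1 a) //= bon eqxx mulr1.
rewrite big1 ?addr0 ?expr2 // => a' a'a.
by rewrite bon (negPf a'a) mulr0.
Qed.

(** Cauchy-Schwarz applied to the coordinates of [p] in an orthonormal basis; by Parseval their
    squares sum to [<p,p>]. *)
Lemma sqr_peval_le (R : realType) (n d : nat) (X : seq 'rV[R]_n)
    (p : mpoly n R) (x : 'rV[R]_n) : nondegenerate_upto d X -> in_poly_le d p ->
  peval p x ^+ 2 <= emp_inner X p p * peval (christoffel d X) x.
Proof.
move=> /christoffelP[b bon ->] pd; have [_ _ /(_ p pd)[c ->]] := bon.
by rewrite emp_inner_orthonormal // peval_sum sqr_sum_mul_le.
Qed.

(* The reproducing kernel of the evaluation at [x]; it attains equality in
   [sqr_peval_le]. *)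
Lemma christoffel_attained (R : realType) (n d : nat) (X : seq 'rV[R]_n)
    (x : 'rV[R]_n) : nondegenerate_upto d X ->
  exists p : mpoly n R, [/\ in_poly_le d p,
    peval p x = peval (christoffel d X) x
    & emp_inner X p p = peval (christoffel d X) x].
Proof.
move=> /christoffelP[b bon PE]; have [bd _ _] := bon.
exists (\sum_a peval (b a) x *: b a); split.
- rewrite /in_poly_le; apply: (leq_trans (msize_sum _ _ _)).
  apply/bigmax_leqP_seq => a _ _; exact: leq_trans (msizeZ_le _ _) (bd a).
- by rewrite peval_sum PE; apply: eq_bigr => a _; rewrite expr2.
- by rewrite emp_inner_orthonormal.
Qed.

(** * Supremum norm on the cube *)

Lemma cube0 (R : realType) (n : nat) : cube R n 0.
Proof. by move=> i; rewrite mxE lerN10 ler01. Qed.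

(** A crude bound that makes the supremum over the cube finite. *)
Lemma norm_peval_le (R : realType) (n : nat) (p : mpoly n R) (x : 'rV[R]_n) :
  cube R n x -> `|peval p x| <= \sum_(m <- msupp p) `|mcoeff m p|.
Proof.
move=> hx; rewrite /peval mevalE.
apply: (le_trans (ler_norm_sum _ _ _)); apply: ler_sum => m _.
rewrite normrM ler_piMr // normr_prod; apply: prodr_ile1 => i _.
rewrite normr_ge0 normrX; apply: exprn_ile1 => //.
by rewrite ler_norml; exact: hx.
Qed.

Lemma peval_le_supnorm (R : realType) (n : nat) (p : mpoly n R)
    (x : 'rV[R]_n) : cube R n x -> `|peval p x| <= supnorm (peval p).
Proof.
move=> hx; apply: ub_le_sup; last by exists x.
by exists (\sum_(m <- msupp p) `|mcoeff m p|) => _ [y hy <-]; exact: norm_peval_le.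
Qed.

Lemma supnorm_peval_ge0 (R : realType) (n : nat) (p : mpoly n R) :
  0 <= supnorm (peval p).
Proof. exact: le_trans (normr_ge0 _) (peval_le_supnorm p (@cube0 R n)). Qed.

Lemma supnorm_le (R : realType) (n : nat) (f : 'rV[R]_n -> R) (B : R) :
  (forall x, cube R n x -> `|f x| <= B) -> supnorm f <= B.
Proof.
move=> fB; apply: ge_sup; first by exists `|f 0|, 0 => //; exact: cube0.
by move=> _ [x hx <-]; exact: fB.
Qed.

Lemma in_poly_le1 (R : realType) (n d : nat) : in_poly_le d (1 : mpoly n R).
Proof. by rewrite /in_poly_le msize1. Qed.

Lemma nondegenerate_size_gt0 (R : realType) (n d : nat) (X : seq 'rV[R]_n) :
  nondegenerate_upto d X -> (0 < size X)%N.
Proof.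
move=> /(_ 1 (in_poly_le1 _ _ _) (oner_neq0 _)).
by case: X => //; rewrite /emp_inner big_nil mulr0 ltxx.
Qed.

Lemma emp_inner1 (R : realType) (n : nat) (X : seq 'rV[R]_n) :
  (0 < size X)%N -> emp_inner X 1 1 = 1.
Proof.
move=> X0; rewrite /emp_inner (eq_bigr (fun=> 1)) => [|x _]; last first.
  by rewrite /peval meval1 mulr1.
by rewrite big_const_seq count_predT iter_addr_0 mulVf // pnatr_eq0 -lt0n.
Qed.

(** The constant polynomial 1 has norm 1 and serves as test function. The positivity that the
    logarithms require follows. *)
Lemma christoffel_ge1 (R : realType) (n d : nat) (X : seq 'rV[R]_n)
    (x : 'rV[R]_n) :
  nondegenerate_upto d X -> 1 <= peval (christoffel d X) x.
Proof.
move=> hX; have := sqr_peval_le x hX (in_poly_le1 _ _ _).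
rewrite emp_inner1 ?(nondegenerate_size_gt0 hX) //.
by rewrite /peval meval1 expr1n mul1r.
Qed.

(** * Couplings and comparison of the empirical inner products *)

(** Links the marginals of couplings, which live on distinct points, to averages over samples with
    repetitions. *)
Lemma sum_emp_mass (R : realType) (n : nat) (X : seq 'rV[R]_n)
    (f : 'rV[R]_n -> R) :
  \sum_(x <- emp_supp X) emp_mass X x * f x
    = (size X)%:R^-1 * \sum_(x <- X) f x.
Proof.
rewrite -(big_undup_iterop_count _ X) mulr_sumr; apply: eq_bigr => x _.
by rewrite /emp_mass mulrAC mulr_natl mulrC.
Qed.

Lemma emp_mass_ge0 (R : realType) (n : nat) (X : seq 'rV[R]_n) x :
  0 <= emp_mass X x.
Proof. by rewrite divr_ge0. Qed.

Lemma emp_mass_total (R : realType) (n : nat) (X : seq 'rV[R]_n) :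
  (0 < size X)%N -> \sum_(x <- emp_supp X) emp_mass X x = 1.
Proof.
move=> X0; under eq_bigr do rewrite -[emp_mass _ _]mulr1.
rewrite (sum_emp_mass _ (fun=> 1)).
by rewrite big_const_seq count_predT iter_addr_0 mulVf // pnatr_eq0 -lt0n.
Qed.

Lemma coupling_prod (R : realType) (n : nat) (X Y : seq 'rV[R]_n) :
  (0 < size X)%N -> (0 < size Y)%N ->
  coupling X Y (fun x y => emp_mass X x * emp_mass Y y).
Proof.
move=> X0 Y0; split=> [x y _ _|x _|y _]; first by rewrite mulr_ge0 ?emp_mass_ge0.
  by rewrite -mulr_sumr emp_mass_total ?mulr1.
by rewrite -mulr_suml emp_mass_total ?mul1r.
Qed.

(** Bounds for all couplings pass to the infimum, without a minimizer. The product coupling shows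
    that couplings exist and settles [K = 0], where division by [K] fails. *)
Lemma le_mul_wasserstein (R : realType) (n : nat) (X Y : seq 'rV[R]_n)
    (A K : R) : (0 < size X)%N -> (0 < size Y)%N -> 0 <= K ->
  (forall g, coupling X Y g -> A <= K * transport_cost X Y g) ->
  A <= K * wasserstein X Y.
Proof.
move=> X0 Y0; have gP := coupling_prod X0 Y0.
rewrite le_eqVlt => /predU1P[<-|K0] hA.
  by have := hA _ gP; rewrite !mul0r.
rewrite mulrC -ler_pdivrMr //; apply: lb_le_inf.
  by eexists; exists (fun x y => emp_mass X x * emp_mass Y y).
by move=> _ [g hg <-]; rewrite ler_pdivrMr // mulrC hA.
Qed.

Lemma wasserstein_ge0 (R : realType) (n : nat) (X Y : seq 'rV[R]_n) :
  (0 < size X)%N -> (0 < size Y)%N -> 0 <= wasserstein X Y.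
Proof.
move=> X0 Y0; rewrite -[leRHS]mul1r; apply: le_mul_wasserstein => // g [g0 _ _].
rewrite mul1r /transport_cost big_seq sumr_ge0 // => x xX.
by rewrite big_seq sumr_ge0 // => y yY; rewrite mulr_ge0 ?g0 ?sqrtr_ge0.
Qed.

Lemma emp_inner_ge0 (R : realType) (n : nat) (X : seq 'rV[R]_n)
    (p : mpoly n R) : 0 <= emp_inner X p p.
Proof.
by rewrite mulr_ge0 ?invr_ge0 // sumr_ge0 // => x _; rewrite -expr2 sqr_ge0.
Qed.

(** The marginal conditions rewrite both averages as double sums against the same [g]. *)
Lemma emp_inner_sub (R : realType) (n : nat) (X Y : seq 'rV[R]_n)
    (p : mpoly n R) g : coupling X Y g ->
  emp_inner X p p - emp_inner Y p p = \sum_(x <- emp_supp X)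
    \sum_(y <- emp_supp Y) g x y * (peval p x ^+ 2 - peval p y ^+ 2).
Proof.
case=> _ gX gY.
rewrite /emp_inner -!(sum_emp_mass _ (fun x => peval p x * peval p x)).
under [RHS]eq_bigr do under eq_bigr do rewrite mulrBr.
under [RHS]eq_bigr do rewrite sumrB.
rewrite sumrB [X in _ = _ - X]exchange_big /=; congr (_ - _); rewrite !big_seq.
  by apply: eq_bigr => x xX; rewrite -mulr_suml gX.
by apply: eq_bigr => y yY; rewrite -mulr_suml gY.
Qed.

(** Double induction along Pascal's rule. *)
Lemma muln_lt_bin (n d : nat) : (n * d < 'C(n + d, d))%N.
Proof.
elim: n d => [|n IHn] d; first by rewrite mul0n bin_gt0 leq_addl.
elim: d => [|d IHd]; first by rewrite muln0 bin0.
have := IHn d.+1; rewrite -addSnnS addnS binS => h.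
by apply: leq_trans (leq_add h IHd); rewrite !mulSn !mulnS; lia.
Qed.

Lemma C_const_ge (n d : nat) : (4 * n * d ^ 3 <= C_const n d)%N.
Proof.
rewrite /C_const expnS mulnA leq_mul2r -mulnA leq_mul2l /= ltnW ?orbT //.
exact: muln_lt_bin.
Qed.

Lemma norm_emp_inner_sub_le (R : realType) (n d : nat) (X Y : seq 'rV[R]_n)
    (p : mpoly n R) :
  (forall x, x \in X -> cube R n x) -> (forall y, y \in Y -> cube R n y) ->
  nondegenerate_upto d X -> nondegenerate_upto d Y -> in_poly_le d p ->
  `|emp_inner X p p - emp_inner Y p p| <=
    (C_const n d)%:R * supnorm (peval (christoffel d X)) * wasserstein X Y
      * emp_inner X p p.
Proof.
move=> hX hY hXd hYd pd.
have [X0 Y0] := (nondegenerate_size_gt0 hXd, nondegenerate_size_gt0 hYd).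
set S := supnorm _; set I := emp_inner X p p.
have I0 : 0 <= I by exact: emp_inner_ge0.
have S0 : 0 <= S by exact: supnorm_peval_ge0.
(* By the extremal property, [M] bounds [p] on the whole cube. *)
pose M := Num.sqrt (S * I).
have M2 : M ^+ 2 = S * I by rewrite sqr_sqrtr // mulr_ge0.
have M0 : 0 <= M by exact: sqrtr_ge0.
have pM z : cube R n z -> `|peval p z| <= M.
  move=> hz; rewrite -sqrtr_sqr ler_sqrt ?(mulr_ge0 S0 I0) //.
  apply: (le_trans (sqr_peval_le z hXd pd)); rewrite mulrC ler_wpM2r //.
  exact: le_trans (ler_norm _) (peval_le_supnorm _ hz).
(* The factor in front of the distance becomes [C_{n,d} * M ^ 2], and the claim can be checked
   coupling by coupling. *)
rewrite mulrAC -[(_ * S) * _]mulrA -M2.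
apply: le_mul_wasserstein => // [|g hg]; first by rewrite mulr_ge0 ?exprn_ge0.
have [g0 _ _] := hg.
rewrite (emp_inner_sub _ hg) /transport_cost mulr_sumr.
apply: (le_trans (ler_norm_sum _ _ _)); rewrite !big_seq.
apply: ler_sum => x xX; rewrite mulr_sumr.
apply: (le_trans (ler_norm_sum _ _ _)); rewrite !big_seq.
apply: ler_sum => y yY; have gxy := g0 x y xX yY.
have [cx cy] : cube R n x /\ cube R n y.
  by split; [apply: hX | apply: hY]; rewrite -mem_undup.
rewrite normrM (ger0_norm gxy) mulrCA ler_wpM2l // subr_sqr normrM.
(* The difference of squares is [(p x - p y) * (p x + p y)]: the Lipschitz bound times [2 * M] gives
   the constant [4 * n * d ^ 3]. *)
apply: (@le_trans _ _
  (n%:R * (2 * d%:R ^+ 3 * M * norm2 (x - y)) * (M + M))).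
  rewrite ler_pM //; first exact: peval_lipschitz pd pM cx cy.
  by apply: (le_trans (ler_normD _ _)); rewrite lerD ?pM.
rewrite [leLHS](_ : _ = (4 * n * d ^ 3)%:R * M ^+ 2 * norm2 (x - y)).
  by rewrite ler_wpM2r ?sqrtr_ge0 // ler_wpM2r ?exprn_ge0 // ler_nat C_const_ge.
by rewrite (natrM _ _ (d ^ 3)) natrX natrM; ring.
Qed.

(** * Comparison of Christoffel polynomials and their logarithms *)

Lemma norm_log10_sub_le (R : realType) (a b t : R) : 0 < a -> 0 < b -> 0 < t ->
  a <= t * b -> b <= t * a -> `|log10 a - log10 b| <= log10 t.
Proof.
move=> a0 b0 t0 ab ba.
have ln10 : 0 < (ln (10 : R))^-1 by rewrite invr_gt0 ln_gt0 // ltr1n.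
rewrite /log10 -mulrBl normrM (gtr0_norm ln10) ler_pM2r //.
rewrite ler_norml lerBrDl lerBlDr lerBlDl.
by rewrite -!lnM ?posrE // !ler_ln ?posrE ?mulr_gt0 // ![_ * t]mulrC ba ab.
Qed.

(** For the kernel [p] of [X] at [x], [P_X(x) ^ 2 = p(x) ^ 2 <= <p,p>_Y * P_Y(x) <= t * P_X(x) *
    P_Y(x)]; then divide by [P_X(x) > 0]. *)
Lemma christoffel_le (R : realType) (n d : nat) (X Y : seq 'rV[R]_n) (t : R)
    (x : 'rV[R]_n) :
  nondegenerate_upto d X -> nondegenerate_upto d Y ->
  (forall p, in_poly_le d p -> emp_inner Y p p <= t * emp_inner X p p) ->
  peval (christoffel d X) x <= t * peval (christoffel d Y) x.
Proof.
move=> hX hY hXY; have [p [pd px pp]] := christoffel_attained x hX.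
have PX := lt_le_trans ltr01 (christoffel_ge1 x hX).
have PY := le_trans ler01 (christoffel_ge1 x hY).
rewrite -(ler_pM2l PX) -expr2 -{1}px.
apply: (le_trans (sqr_peval_le x hY pd)).
rewrite mulrA [_ * t]mulrC ler_wpM2r // -pp; exact: hXY.
Qed.

Theorem proposition19 (R : realType) (n d : nat) (hn : (1 <= n)%N)
  (X Y : seq 'rV[R]_n)
  (hX : forall x, x \in X -> cube R n x)
  (hXd : nondegenerate_upto d X)
  (hY : forall y, y \in Y -> cube R n y)
  (hYd : nondegenerate_upto d Y)
  (hW : (C_const n d)%:R * supnorm (peval (christoffel d X))
          * wasserstein X Y <= 1 / 2) :
  supnorm (peval (christoffel d Y)) <= 2 * supnorm (peval (christoffel d X))
  /\
  supnorm (fun x => log10 (peval (christoffel d X) x)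
                    - log10 (peval (christoffel d Y) x))
  <= log10 ((C_const n d)%:R * (2 * supnorm (peval (christoffel d X)))
              * wasserstein X Y + 1).
Proof.
have [X0 Y0] := (nondegenerate_size_gt0 hXd, nondegenerate_size_gt0 hYd).
have := norm_emp_inner_sub_le hX hY hXd hYd.
set S := supnorm (peval (christoffel d X)) in hW *.
rewrite (_ : _ * (2 * S) * _ = 2 * ((C_const n d)%:R * S * wasserstein X Y));
  last by ring.
have S0 : 0 <= S by exact: supnorm_peval_ge0.
have : 0 <= (C_const n d)%:R * S * wasserstein X Y.
  by rewrite !mulr_ge0 // wasserstein_ge0.
(* From here on only [0 <= e <= 1/2] and the closeness of the two quadratic forms matter. *)
move: (_ * wasserstein X Y) hW => e e2 e0 close.
have YX x : peval (christoffel d Y) x <= (2 * e + 1) * peval (christoffel d X) x.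
  apply: christoffel_le => // p pd.
  have := close p pd; rewrite ler_norml => /andP[_ XY].
  have I0 := emp_inner_ge0 X p.
  (* Closeness gives [(1 - e) * <p,p>_X <= <p,p>_Y], and [(1 + 2e) * (1 - e) = 1 + e * (1 - 2e)] is
     at least 1 because [e <= 1/2]. *)
  have e1 : 0 <= e * emp_inner X p p * (1 - 2 * e).
    by apply: mulr_ge0; [exact: mulr_ge0 | lra].
  have e3 : 0 <= 2 * e + 1 by lra.
  have := ler_wpM2l e3 XY.
  by lra.
have XY x : peval (christoffel d X) x <= (2 * e + 1) * peval (christoffel d Y) x.
  apply: christoffel_le => // p pd.
  have := close p pd; rewrite ler_norml => /andP[XY _].
  have I0 := emp_inner_ge0 X p.
  by nra.
have PX x := lt_le_trans ltr01 (christoffel_ge1 x hXd).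
have PY x := lt_le_trans ltr01 (christoffel_ge1 x hYd).
split; apply: supnorm_le => x hx; last by rewrite norm_log10_sub_le //; lra.
(* Since [e <= 1/2], the factor [2 * e + 1] is at most 2. *)
rewrite gtr0_norm //; apply: (le_trans (YX x)).
have := peval_le_supnorm (christoffel d X) hx; rewrite gtr0_norm // => PS.
by apply: ler_pM => //; [lra|exact: ltW|lra].
Qed.
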